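(* Let $\Psi^{\delta t}$ be a one-step numerical method of order $r$. Let $U^0\mapsto\Phi(U^0)=U^1$ be the target one-step map obtained on a uniform mesh of $\Omega=[0,1]^2$ with mesh size $\delta x$ and with time step $\delta t$, for the PDE $$\partial_t u = \mathcal{L}u + \sum_{i=1}^I\beta_i\,\mathcal{D}_i^a u\cdot\mathcal{D}_i^b u,\qquad \beta_i\in\mathbb{R},$$ with periodic boundary conditions, where $\mathcal{L},\mathcal{D}_i^a,\mathcal{D}_i^b$ are linear differential operators in space of order at most two. Assume the measurement error $\varepsilon^1$ is either zero or of order at least $r$ in time and $2$ in space, i.e. $\|\varepsilon^1\|=\mathcal{O}(\delta x^2)+\mathcal{O}(\delta t^{r+1})$. Then the map $U^0\mapsto\Psi^{\delta t}_{F_\theta}(U^0)$, with $$F_\theta(U)=\mathcal{H}*\sigma_2\left(\mathcal{K}*U+b_1\right)+b_2,\qquad \sigma_2(x)=\max\{0,x\}^2 \text{ applied entry-wise},$$ $$\mathcal{K}\in\mathbb{R}^{(4+6I)\times 1\times 3\times 3},\quad \mathcal{H}\in\mathbb{R}^{1\times (4+6I)\times 1\times 1},\quad b_1\in\mathbb{R}^{4+6I},\quad b_2\in\mathbb{R},$$ can provide an approximation of $\Phi$ accurate to order $2$ in space and $r$ in time. That is, for each considered pair $(\delta x,\delta t)$ there exist parameters $\theta=(\mathcal{K},\mathcal{H},b_1,b_2)$, not depending on $U^0$, such that $$\left\|\Phi(U^0)-\Psi^{\delta t}_{F_\theta}(U^0)\right\| \le \mathcal{O}(\delta x^2)+\mathcal{O}(\delta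 t^{r+1})$$ for all considered initial data $U^0$.
   Context: Grid and semi-discretization. The domain $[0,1]^2$ carries a uniform grid with $p$ points $(x_h,y_k)$, $h,k=1,\dots,p$, along each axis and spacing $\delta x$; grid functions are matrices in $\mathbb{R}^{p\times p}$ and $\|\cdot\|$ is the Frobenius norm. The spatial semi-discretization of the PDE by second-order accurate finite differences is the ODE $\dot U=F(U)$ with $$F(U)=L*U+\sum_{i=1}^I\beta_i\,(D_{2i-1}*U)\odot(D_{2i}*U),$$ where $L,D_1,\dots,D_{2I}\in\mathbb{R}^{3\times3}$ are finite difference filters (depending on $\delta x$), $L*U$, $D_{2i-1}*U$, $D_{2i}*U$ being second-order accurate approximations of $\mathcal{L}u$, $\mathcal{D}^a_iu$, $\mathcal{D}^b_iu$ on the grid, and $\odot$ is the entry-wise product. Data. $u$ is a (sufficiently regular) solution of the PDE, $U^0_{hk}=u(0,x_h,y_k)$, and $U^1_{hk}=u(\delta t,x_h,y_k)+\varepsilon^1_{hk}$, where $\varepsilon^1\in\mathbb{R}^{p\times p}$ is the measurement error. The considered initial data $U^0$ are the grid samples of the considered solutions $u$ at time $0$. Let $\Phi_F^t$ be the exact time-$t$ flow map of $\dot U=F(U)$. Since the spatial discretization is of second order, it is assumed that $$U^1=\Phi_F^{\delta t}(U^0)+\mathcal{O}(\delta x^2)+\varepsilon^1 .$$ Numerical method. $\Psi^{\delta t}$ assigns to each vector field $G$ on $\mathbb{R}^{p\times p}$ a one-step map $\Psi^{\delta t}_G:\mathbb{R}^{p\times p}\to\mathbb{R}^{p\times p}$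 depending only on $G$ and $\delta t$. That it is of order $r$ means its local error for $F$ satisfies $\Psi^{\delta t}_F(U^0)=\Phi^{\delta t}_F(U^0)+\mathcal{O}(\delta t^{r+1})$. Here $\mathcal{O}(\cdot)$ denotes a quantity whose Frobenius norm (or absolute value) is bounded by a constant times the argument, the constant being independent of $\delta x$ and $\delta t$ in the range of discretization parameters considered (it may depend on the solution $u$). Convolution. For $K\in\mathbb{R}^{3\times 3}$ and $U\in\mathbb{R}^{p\times p}$, $K*U\in\mathbb{R}^{p\times p}$ is the ''same'' convolution with periodic padding, $$(K*U)_{hk}=\sum_{a=1}^{3}\sum_{b=1}^{3}K_{ab}\,U_{h+a-2,\;k+b-2},$$ with indices of $U$ taken modulo $p$ in $\{1,\dots,p\}$; for a $1\times1$ filter $K\in\mathbb{R}$, $K*U=KU$. For $\boldsymbol{U}\in\mathbb{R}^{C_i\times p\times p}$ and $\mathcal{K}\in\mathbb{R}^{C_o\times C_i\times s\times s}$ with filters $\mathcal{K}_{i,j}\in\mathbb{R}^{s\times s}$, $(\mathcal{K}*\boldsymbol{U})_i=\sum_{j=1}^{C_i}\mathcal{K}_{i,j}*\boldsymbol{U}_j$ for $i=1,\dots,C_o$. A matrix in $\mathbb{R}^{p\times p}$ is identified with a tensor in $\mathbb{R}^{1\times p\times p}$. Adding a bias $b\in\mathbb{R}^{C_o}$ to a tensor in $\mathbb{R}^{C_o\times p\times p}$ means adding $b_i$ to every entry of the $i$-th channel. *)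

(* Defs.v *)
From mathcomp Require Export all_boot all_order all_algebra.
From mathcomp Require Export all_classical all_reals all_analysis.

Set Implicit Arguments.
Unset Strict Implicit.
Unset Printing Implicit Defensive.

Import Order.TTheory GRing.Theory Num.Theory.
Import numFieldNormedType.Exports.
Local Open Scope classical_set_scope.
Local Open Scope ring_scope.

(** * Grid functions and convolutions *)

Definition frob (R : realType) (m n : nat) (U : 'M[R]_(m, n)) : R :=
  Num.sqrt (\sum_(h < m) \sum_(k < n) U h k ^+ 2).

(* Indices start at 0 here, so the entry of U met by the filter entry (a, b) at
   the node (h, k) is (h + a - s./2, k + b - s./2) modulo p; for s = 3 and
   indices starting at 1 this is (h + a - 2, k + b - 2), for s = 1 it is
   (h, k). [ordS] and [ord_pred] are the cyclic successor and predecessor. *)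
Definition pshift (p s : nat) (a : 'I_s) (h : 'I_p) : 'I_p :=
  iter a (@ordS p) (iter s./2 (@ord_pred p) h).

Definition pconv (R : realType) (s p : nat) (K : 'M[R]_s) (U : 'M[R]_p) :
    'M[R]_p :=
  \matrix_(h, k) \sum_(a < s) \sum_(b < s) K a b * U (pshift a h) (pshift b k).

Lemma pconv1E (R : realType) (p : nat) (K : 'M[R]_1) (U : 'M[R]_p) :
  pconv K U = K ord0 ord0 *: U.
Proof. by apply/matrixP => h k; rewrite !mxE !big_ord1. Qed.

Lemma pconv3E (R : realType) (p : nat) (K : 'M[R]_3) (U : 'M[R]_p.+1)
    (h k : 'I_p.+1) :
  pconv K U h k =
  \sum_(a < 3) \sum_(b < 3) K a b * U (inord ((h + a + p) %% p.+1)%N)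
                                      (inord ((k + b + p) %% p.+1)%N).
Proof.
suff E (a : 'I_3) (i : 'I_p.+1) : pshift a i = inord ((i + a + p) %% p.+1)%N.
  by rewrite mxE; apply: eq_bigr => a _; apply: eq_bigr => b _; rewrite !E.
have S3 n (j : 'I_p.+1) :
    iter n (@ordS p.+1) j = ((j + n) %% p.+1)%N :> nat.
  elim: n => [|n IH] /=; first by rewrite addn0 modn_small.
  by rewrite IH -addn1 modnDml addn1 addnS.
apply: ord_inj; rewrite /pshift S3 inordK ?ltn_pmod//=.
by rewrite addnS /= modnDml addnAC.
Qed.

(* An element of R^{C x p x p}; a p x p matrix is the tensor [fun _ => U] with
   one channel. *)
Definition tensor (R : realType) (C p : nat) := 'I_C -> 'M[R]_p.

Definition tconv (R : realType) (Co Ci s p : nat)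
    (K : 'I_Co -> 'I_Ci -> 'M[R]_s) (U : tensor R Ci p) : tensor R Co p :=
  fun i => \sum_(j < Ci) pconv (K i j) (U j).

Definition add_bias (R : realType) (C p : nat) (U : tensor R C p)
    (b : 'I_C -> R) : tensor R C p :=
  fun i => U i + const_mx (b i).

(** * The network *)

Definition sigma2 (R : realType) (x : R) : R := Num.max 0 x ^+ 2.

Record params (R : realType) (C : nat) := Params {
  par_K : 'I_C -> 'I_1 -> 'M[R]_3;
  par_H : 'I_1 -> 'I_C -> 'M[R]_1;
  par_b1 : 'I_C -> R;
  par_b2 : R }.

Definition Ftheta (R : realType) (C p : nat) (theta : params R C)
    (U : 'M[R]_p) : 'M[R]_p :=
  let Z := add_bias (tconv (par_K theta) (fun _ : 'I_1 => U)) (par_b1 theta) in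
  add_bias (tconv (par_H theta) (fun i => map_mx (@sigma2 R) (Z i)))
    (fun _ : 'I_1 => par_b2 theta) ord0.

(** * The PDE *)

Definition dx (R : realType) (v : R -> R -> R) : R -> R -> R :=
  fun x y => derive1 (fun x' => v x' y) x.

Definition dy (R : realType) (v : R -> R -> R) : R -> R -> R :=
  fun x y => derive1 (fun y' => v x y') y.

Fixpoint Ck (R : realType) (k : nat) (v : R -> R -> R) : Prop :=
  continuous (fun z : R * R => v z.1 z.2) /\
  match k with
  | 0%N => True
  | j.+1 => [/\ forall x y, derivable (fun x' => v x' y) x 1,
                forall x y, derivable (fun y' => v x y') y 1,
                Ck j (dx v) & Ck j (dy v)]
  end.

(* A linear differential operator of order at most two, given by its
   coefficients: c i j is the (possibly nonconstant) coefficient of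
   d^(i+j) / dx^i dy^j, and only the c i j with i + j <= 2 matter. *)
Definition diffop (R : realType) := nat -> nat -> R -> R -> R.

Definition apply_op (R : realType) (c : diffop R) (v : R -> R -> R) :
    R -> R -> R :=
  fun x y => \sum_(i < 3) \sum_(j < 3 | (i + j <= 2)%N)
    c i j x y * iter i (@dx R) (iter j (@dy R) v) x y.

Record quad_pde (R : realType) (nI : nat) := QuadPDE {
  op_L : diffop R;
  op_a : 'I_nI -> diffop R;
  op_b : 'I_nI -> diffop R;
  pde_beta : 'I_nI -> R }.

Definition pde_rhs (R : realType) (nI : nat) (E : quad_pde R nI)
    (v : R -> R -> R) (x y : R) : R :=
  apply_op (op_L E) v x y +
  \sum_(i < nI) pde_beta E i * (apply_op (op_a E i) v x y *
                            apply_op (op_b E i) v x y).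

(* Classical solutions on [0, T] x [0, 1]^2 with periodic boundary conditions,
   extended periodically in space. *)
Definition pde_solution (R : realType) (nI : nat) (E : quad_pde R nI) (T : R)
    (u : R -> R -> R -> R) : Prop :=
  [/\ forall t x y, 0 <= t <= T ->
        u t (x + 1) y = u t x y /\ u t x (y + 1) = u t x y,
      forall t, 0 <= t <= T -> Ck 2 (u t),
      forall x y, {within `[0, T], continuous (fun t => u t x y)} &
      forall t x y, 0 < t < T -> 0 <= x <= 1 -> 0 <= y <= 1 ->
        is_derive t 1 (fun s => u s x y) (pde_rhs E (u t) x y)].

(** * Semi-discretization *)

(* Periodic uniform grid with p nodes along each axis: the node with index p
   (coordinate 1) is identified with the node with index 0. *)
Definition mesh (R : realType) (p : nat) : R := p%:R^-1.

Definition node (R : realType) (p : nat) (h : 'I_p) : R := h%:R * mesh R p.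

Definition sample (R : realType) (p : nat) (v : R -> R -> R) : 'M[R]_p :=
  \matrix_(h, k) v (node R h) (node R k).

(* The grid data at time dt, with measurement error eps. *)
Definition target (R : realType) (eps : (R -> R -> R -> R) ->
    forall p : nat, R -> 'M[R]_p) (u : R -> R -> R -> R) (p : nat) (dt : R) :
    'M[R]_p :=
  sample p (u dt) + eps u p dt.

(* The filters L, D_{2i-1} and D_{2i}. *)
Record filters (R : realType) (nI : nat) := Filters {
  fil_L : 'M[R]_3;
  fil_a : 'I_nI -> 'M[R]_3;
  fil_b : 'I_nI -> 'M[R]_3 }.

Definition hadamard (R : realType) (p : nat) (A B : 'M[R]_p) : 'M[R]_p :=
  \matrix_(h, k) (A h k * B h k).

Definition semi_rhs (R : realType) (nI p : nat) (bet : 'I_nI -> R)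
    (D : filters R nI) (U : 'M[R]_p) : 'M[R]_p :=
  pconv (fil_L D) U +
  \sum_(i < nI) bet i *: hadamard (pconv (fil_a D i) U) (pconv (fil_b D i) U).

(* Below, [adm p dt] says that the pair (mesh R p, dt) is one of the
   discretization parameters considered; the constants are uniform over these
   pairs and may depend on u. *)

(* Along the solution u, the filters K p are second-order accurate
   approximations of the operator c at the grid nodes. *)
Definition second_order_along (R : realType) (adm : nat -> R -> Prop) (T : R)
    (K : nat -> 'M[R]_3) (c : diffop R) (u : R -> R -> R -> R) : Prop :=
  exists C : R, forall p dt, adm p dt -> forall t, 0 <= t <= T ->
    forall h k : 'I_p,
      `|pconv (K p) (sample p (u t)) h k
        - apply_op c (u t) (node R h) (node R k)| <= C * mesh R p ^+ 2.

Definition second_order_filters (R : realType) (nI : nat)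
    (adm : nat -> R -> Prop) (T : R) (E : quad_pde R nI)
    (D : nat -> filters R nI) (u : R -> R -> R -> R) : Prop :=
  [/\ second_order_along adm T (fun p => fil_L (D p)) (op_L E) u,
      forall i, second_order_along adm T (fun p => fil_a (D p) i) (op_a E i) u
    & forall i,
        second_order_along adm T (fun p => fil_b (D p) i) (op_b E i) u].

(* W is the value at U of the exact time-t flow of dU/dt = G(U). The flow is
   given by its graph because solutions of the quadratic ODE may blow up before
   time t; W is unique when G is locally Lipschitz. *)
Definition is_flow (R : realType) (p : nat) (G : 'M[R]_p -> 'M[R]_p) (t : R)
    (U W : 'M[R]_p) : Prop :=
  exists V : R -> 'M[R]_p,
    [/\ V 0 = U, V t = W,
        forall h k, {within `[0, t], continuous (fun s => V s h k)} &
        forall s, 0 < s < t -> forall h k,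
          is_derive s 1 (fun s' => V s' h k) (G (V s) h k)].

(** * One-step methods *)

(* Psi p dt G is the one-step map on p x p matrices for the vector field G. *)
Definition one_step_method (R : realType) :=
  forall p : nat, R -> ('M[R]_p -> 'M[R]_p) -> 'M[R]_p -> 'M[R]_p.

(* Local error of order r + 1 for the vector fields F p, started from the grid
   samples of u at time 0. *)
Definition order_along (R : realType) (adm : nat -> R -> Prop) (r : nat)
    (Psi : one_step_method R) (F : forall p : nat, 'M[R]_p -> 'M[R]_p)
    (u : R -> R -> R -> R) : Prop :=
  exists C : R, forall p dt, adm p dt -> forall W : 'M[R]_p,
    is_flow (F p) dt (sample p (u 0)) W ->
    frob (Psi p dt (F p) (sample p (u 0)) - W) <= C * dt ^+ r.+1.

(* Main.v *)
(* Since [sigma2 z + sigma2 (- z) = z ^+ 2], a pair of channels computes the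
   square of an affine filter response. As [z = ((z + 1)^2 - (z - 1)^2) / 4] and
   [z w = ((z + w)^2 - z^2 - w^2) / 2], two squares give the linear term and
   three squares give each quadratic term, so 2 (2 + 3 I) channels represent the
   semi-discrete vector field exactly. The one-step map is then that of the
   exact vector field, and the error splits into the spatial error, the
   measurement error and the local error of the method. *)
Require Import Defs.
From mathcomp Require Import ring lra zify.

Import Order.TTheory GRing.Theory Num.Theory.
Import numFieldNormedType.Exports.
Local Open Scope classical_set_scope.
Local Open Scope ring_scope.

Lemma frob_ge0 {R : realType} {m n : nat} (A : 'M[R]_(m, n)) : 0 <= frob A.
Proof. exact: sqrtr_ge0. Qed.

Lemma sqr_frob {R : realType} {m n : nat} (A : 'M[R]_(m, n)) :
  frob A ^+ 2 = \sum_h \sum_k A h k ^+ 2.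
Proof.
rewrite sqr_sqrtr// sumr_ge0// => h _.
by rewrite sumr_ge0// => k _; exact: sqr_ge0.
Qed.

Lemma frobN {R : realType} {m n : nat} (A : 'M[R]_(m, n)) : frob (- A) = frob A.
Proof.
congr Num.sqrt; apply: eq_bigr => h _.
by apply: eq_bigr => k _; rewrite mxE sqrrN.
Qed.

Lemma frob_eq0 {R : realType} {m n : nat} {A : 'M[R]_(m, n)} :
  frob A = 0 -> A = 0.
Proof.
move=> A0; have := sqr_frob A; rewrite A0 expr0n /= => /esym /eqP.
have row_ge0 h : 0 <= \sum_k A h k ^+ 2.
  by rewrite sumr_ge0// => k _; exact: sqr_ge0.
rewrite psumr_eq0// => /allP rows0.
apply/matrixP => h k; rewrite mxE; apply/eqP; rewrite -sqrf_eq0.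
have := rows0 h (mem_index_enum _); rewrite psumr_eq0/= => [/allP cols0|k' _].
  exact: cols0 (mem_index_enum _).
exact: sqr_ge0.
Qed.

(** The sum of squares of the entries of [frob A * B - frob B * A] is nonnegative. Expanding it and
    dividing by twice the product of the norms gives the bound, so vanishing norms are handled
    apart. *)
Lemma frob_cauchy_schwarz {R : realType} {m n : nat} (A B : 'M[R]_(m, n)) :
  \sum_h \sum_k A h k * B h k <= frob A * frob B.
Proof.
have [A0|A_neq0] := eqVneq (frob A) 0.
  rewrite A0 mul0r (frob_eq0 A0) big1// => h _.
  by rewrite big1// => k _; rewrite mxE mul0r.
have [B0|B_neq0] := eqVneq (frob B) 0.
  rewrite B0 mulr0 (frob_eq0 B0) big1// => h _.
  by rewrite big1// => k _; rewrite mxE mulr0.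
have AB_gt0 : 0 < frob A * frob B by rewrite mulr_gt0// lt_def frob_ge0 andbT.
have : 0 <= \sum_h \sum_k (frob A * B h k - frob B * A h k) ^+ 2.
  by apply: sumr_ge0 => h _; apply: sumr_ge0 => k _; exact: sqr_ge0.
have -> : \sum_h \sum_k (frob A * B h k - frob B * A h k) ^+ 2 =
    frob A ^+ 2 * (\sum_h \sum_k B h k ^+ 2) +
    frob B ^+ 2 * (\sum_h \sum_k A h k ^+ 2) -
    2 * (frob A * frob B) * \sum_h \sum_k A h k * B h k.
  rewrite !mulr_sumr -big_split -sumrB; apply: eq_bigr => h _ /=.
  rewrite !mulr_sumr -big_split -sumrB; apply: eq_bigr => k _ /=.
  by ring.
rewrite -!sqr_frob => sq_ge0.
by rewrite -(ler_pM2l AB_gt0); lra.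
Qed.

Lemma frobD {R : realType} {m n : nat} (A B : 'M[R]_(m, n)) :
  frob (A + B) <= frob A + frob B.
Proof.
rewrite -ler_sqr ?nnegrE ?addr_ge0 ?frob_ge0// sqrrD !sqr_frob.
have -> : \sum_h \sum_k (A + B) h k ^+ 2 =
    \sum_h \sum_k A h k ^+ 2 + (\sum_h \sum_k A h k * B h k) *+ 2 +
    \sum_h \sum_k B h k ^+ 2.
  rewrite -sumrMnl -!big_split; apply: eq_bigr => h _ /=.
  rewrite -sumrMnl -!big_split; apply: eq_bigr => k _ /=.
  by rewrite mxE sqrrD.
by rewrite lerD2r lerD2l lerMn2r /= frob_cauchy_schwarz.
Qed.

Lemma pconvDl (R : realType) (s p : nat) (K1 K2 : 'M[R]_s) (U : 'M[R]_p) :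
  pconv (K1 + K2) U = pconv K1 U + pconv K2 U.
Proof.
apply/matrixP => h k; rewrite !mxE -big_split; apply: eq_bigr => a _ /=.
by rewrite -big_split; apply: eq_bigr => b _; rewrite mxE mulrDl.
Qed.

Lemma pconvZl (R : realType) (s p : nat) (c : R) (K : 'M[R]_s) (U : 'M[R]_p) :
  pconv (c *: K) U = c *: pconv K U.
Proof.
apply/matrixP => h k; rewrite !mxE mulr_sumr; apply: eq_bigr => a _.
by rewrite mulr_sumr; apply: eq_bigr => b _; rewrite mxE mulrA.
Qed.

(** The rectifier cuts one of [x] and [- x] to zero; the other contributes the whole square. *)
Lemma sigma2_pm (R : realType) (x : R) : sigma2 x + sigma2 (- x) = x ^+ 2.
Proof.
rewrite /sigma2; have [x_ge0|x_lt0] := leP 0 x.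
  by rewrite max_l ?oppr_le0// expr0n addr0.
by rewrite max_r ?oppr_ge0 ?ltW// expr0n add0r sqrrN.
Qed.

Lemma FthetaE (R : realType) (C p : nat) (theta : params R C) (U : 'M[R]_p)
    (h k : 'I_p) :
  Ftheta theta U h k =
  \sum_j par_H theta ord0 j ord0 ord0 *
    sigma2 (pconv (par_K theta j ord0) U h k + par_b1 theta j) + par_b2 theta.
Proof.
rewrite /Ftheta /add_bias /tconv !mxE summxE; congr (_ + _).
by apply: eq_bigr => j _; rewrite pconv1E !mxE big_ord1 mxE.
Qed.

(** This allows channels to be labelled by a structured finite type instead of by arithmetic on
    ordinals. *)
Lemma sum_ord_enum_val {R : realType} {A : finType} {C : nat} (cardA : #|A| = C)
    (f : A -> R) :
  \sum_(j < C) f (enum_val (cast_ord (esym cardA) j)) = \sum_x f x.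
Proof.
rewrite (reindex (fun x : A => cast_ord cardA (enum_rank x))) /=.
  by apply: eq_bigr => x _; rewrite cast_ordK enum_rankK.
exists (fun j => enum_val (cast_ord (esym cardA) j)) => x _.
  by rewrite cast_ordK enum_rankK.
by rewrite enum_valK cast_ordKV.
Qed.

(* The boolean component of a channel is the sign of its argument. *)
Definition square_params {R : realType} {B : finType} {C : nat}
    (cardB : #|{: bool * B}| = C) (K : B -> 'M[R]_3) (bias weight : B -> R) :
    params R C :=
  let chan j := enum_val (cast_ord (esym cardB) j) in
  Params (fun j _ => (-1) ^+ (chan j).1 *: K (chan j).2)
    (fun _ j => (weight (chan j).2)%:M)
    (fun j => (-1) ^+ (chan j).1 * bias (chan j).2) 0.

Lemma Ftheta_square_params (R : realType) (B : finType) (C p : nat)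
    (cardB : #|{: bool * B}| = C) (K : B -> 'M[R]_3) (bias weight : B -> R)
    (U : 'M[R]_p) (h k : 'I_p) :
  Ftheta (square_params cardB K bias weight) U h k =
  \sum_x weight x * (pconv (K x) U h k + bias x) ^+ 2.
Proof.
rewrite FthetaE /= addr0.
(* The sign multiplies both filter and bias, so it factors out of the whole affine response. *)
pose f (x : bool * B) := weight x.2 *
  sigma2 ((-1) ^+ x.1 * (pconv (K x.2) U h k + bias x.2)).
transitivity (\sum_x f x); first rewrite -(sum_ord_enum_val cardB f).
  by apply: eq_bigr => j _; rewrite pconvZl mxE mxE eqxx mulr1n -mulrDr.
transitivity (\sum_s \sum_x f (s, x)).
  by rewrite pair_bigA; apply: eq_bigr => -[].
rewrite big_bool /= -big_split /=.
apply: eq_bigr => x _.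
by rewrite /f /= expr1 expr0 mul1r mulN1r -mulrDr addrC sigma2_pm.
Qed.

(* The last three summands stand for (z + w)^2, z^2 and w^2, where z and w are
   the filter responses of the i-th product. *)
Definition square_index (nI : nat) : finType :=
  (bool + ('I_nI + ('I_nI + 'I_nI)))%type.

Lemma card_square_index (nI : nat) :
  #|{: bool * square_index nI}| = (4 + 6 * nI)%N.
Proof. by rewrite card_prod !card_sum card_bool card_ord; lia. Qed.

(** In [inl s], the boolean [s] selects [z + 1] or [z - 1], so one sign gives both the bias and the
    sign of the weight; it is unrelated to the channel sign in [square_params]. *)
Definition semi_params {R : realType} {nI : nat} (bet : 'I_nI -> R)
    (D : filters R nI) : params R (4 + 6 * nI) :=
  square_params (card_square_index nI)
    (fun x => match x with
      | inl _ => fil_L D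
      | inr (inl i) => fil_a D i + fil_b D i
      | inr (inr (inl i)) => fil_a D i
      | inr (inr (inr i)) => fil_b D i
      end)
    (fun x => if x is inl s then (-1) ^+ s else 0)
    (fun x => match x with
      | inl s => (-1) ^+ s / 4
      | inr (inl i) => bet i / 2
      | inr (inr (inl i)) => - (bet i / 2)
      | inr (inr (inr i)) => - (bet i / 2)
      end).

(** Equality as functions, on all matrices, permits replacing the vector field inside [Psi] with no
    continuity assumption on the method. *)
Lemma Ftheta_semi_params {R : realType} {nI p : nat} (bet : 'I_nI -> R)
    (D : filters R nI) :
  Ftheta (p := p) (semi_params bet D) = semi_rhs bet D.
Proof.
apply/funext => U; apply/matrixP => h k.
rewrite Ftheta_square_params !big_sumType /= big_bool /= expr1 expr0.
rewrite [RHS]mxE summxE; congr (_ + _); first by field.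
rewrite -!big_split /=; apply: eq_bigr => i _.
by rewrite !addr0 pconvDl [RHS]mxE [in RHS]mxE mxE; field.
Qed.

Theorem corollary1 (R : realType) (nI r : nat) (E : quad_pde R nI) (T : R)
  (adm : nat -> R -> Prop)
  (adm_pos : forall p dt, adm p dt -> (0 < p)%N /\ 0 < dt <= T)
  (sols : set (R -> R -> R -> R))
  (sols_pde : forall u, sols u -> pde_solution E T u)
  (D : nat -> filters R nI)
  (D_acc : forall u, sols u -> second_order_filters adm T E D u)
  (eps : (R -> R -> R -> R) -> forall p : nat, R -> 'M[R]_p)
  (eps_small : forall u, sols u -> exists C1 C2 : R,
     forall p dt, adm p dt ->
     frob (eps u p dt) <= C1 * mesh R p ^+ 2 + C2 * dt ^+ r.+1)
  (semi_acc : forall u, sols u -> exists C : R,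
     forall p dt, adm p dt -> exists W : 'M[R]_p,
     is_flow (@semi_rhs R nI p (pde_beta E) (D p)) dt (sample p (u 0)) W /\
     frob (target eps u p dt - (W + eps u p dt)) <= C * mesh R p ^+ 2)
  (Phi : forall p : nat, R -> 'M[R]_p -> 'M[R]_p)
  (Phi_target : forall u, sols u -> forall p dt, adm p dt ->
     Phi p dt (sample p (u 0)) = target eps u p dt)
  (Psi : one_step_method R)
  (Psi_order : forall u, sols u ->
     order_along adm r Psi (fun p => @semi_rhs R nI p (pde_beta E) (D p)) u) :
  exists theta : nat -> R -> params R (4 + 6 * nI),
  forall u, sols u -> exists C1 C2 : R,
  forall p dt, adm p dt ->
    frob (Phi p dt (sample p (u 0))
          - Psi p dt (@Ftheta R (4 + 6 * nI) p (theta p dt)) (sample p (u 0)))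
      <= C1 * mesh R p ^+ 2 + C2 * dt ^+ r.+1.
Proof.
(* The parameters are fixed before [u] and depend on the mesh only through [D p]. *)
exists (fun p _ => semi_params (pde_beta E) (D p)) => u u_sol.
have [Ce1 [Ce2 eps_le]] := eps_small u u_sol.
have [Cs semi_le] := semi_acc u u_sol.
have [Cm Psi_le] := Psi_order u u_sol.
(* [Cs] bounds the spatial error, [Ce1] and [Ce2] the measurement error, [Cm] the local error of the
   method. *)
exists (Cs + Ce1), (Ce2 + Cm) => p dt adm_dt.
have [W [flowW W_le]] := semi_le p dt adm_dt.
rewrite Phi_target// Ftheta_semi_params.
set V := Psi _ _ _ _.
(* The exact flow value [W] is inserted between data and method; [V - W] keeps the orientation of
   the local error bound. *)
have -> : target eps u p dt - V =
    (target eps u p dt - (W + eps u p dt)) + (eps u p dt + - (V - W)).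
  by rewrite opprB [eps u p dt + _]addrA [eps u p dt + W]addrC addrA subrK.
apply: le_trans (frobD _ _) _.
apply: le_trans (lerD W_le (frobD _ _)) _; rewrite frobN.
by have := eps_le p dt adm_dt; have := Psi_le p dt adm_dt W flowW; lra.
Qed.
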